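(* Let $A, B\in \mathbb{C}^{m\times n}$ be such that $BA^*=0$ (that is, $A$ is right $*$-orthogonal to $B$). Then $A$ is parallel summable to $B$ if and only if $\mathcal{R}(\overline{Q}_AB^*A)\subseteq \mathcal{R}(\overline{Q}_A B^*\overline{P}_A)$. In this case, $A:B=0$.
   Context: $M^*$ is the conjugate transpose, $\mathcal{R}(M)$ the column space, and $M^\dagger$ the Moore-Penrose inverse of $M$. Put $\overline{P}_A=I_m-AA^\dagger$ and $\overline{Q}_A=I_n-A^\dagger A$. A $g$-inverse (inner inverse) of $M\in\mathbb{C}^{m\times n}$ is any matrix $M^-\in\mathbb{C}^{n\times m}$ with $MM^-M=M$. Matrices $A,B\in \mathbb{C}^{m\times n}$, at least one of which is nonzero, are called parallel summable if $A(A+B)^{-}B$ is invariant under the choice of the $g$-inverse $(A+B)^{-}$ of $A+B$; in that case the common value is called the parallel sum of $A$ and $B$ and is denoted $A:B$ (so $A:B=A(A+B)^\dagger B$). ''$A$ is parallel summable to $B$'' means that $A$ and $B$ are parallel summable. *)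

(* Defs.v *)
From HB Require Import structures.
From mathcomp Require Import all_boot all_order all_algebra.
From mathcomp Require Export spectral reals complex.

Set Implicit Arguments.
Unset Strict Implicit.
Unset Printing Implicit Defensive.

Import Order.TTheory GRing.Theory Num.Theory.

Local Open Scope ring_scope.
Local Open Scope sesquilinear_scope.

Section Matrices.
Variable C : numClosedFieldType.

Definition penrose m n (M : 'M[C]_(m, n)) (X : 'M[C]_(n, m)) : bool :=
  [&& M *m X *m M == M, X *m M *m X == X,
      (M *m X)^t* == M *m X & (X *m M)^t* == X *m M].

Lemma trmxC_mul m n p (A : 'M[C]_(m, n)) (B : 'M[C]_(n, p)) :
  (A *m B)^t* = B^t* *m A^t*.
Proof. by rewrite trmx_mul map_mxM. Qed.

Lemma mulmxtC_eq0 m n (A : 'M[C]_(m, n)) : A *m A^t* = 0 -> A = 0.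
Proof.
move=> AA0; apply/row_matrixP=> i; rewrite row0; apply/eqP/contraT.
move/(@dotmx_is_dotmx C n); rewrite dotmxE.
suff -> : (row i A *m (row i A)^t*) 0 0 = (A *m A^t*) i i.
  by rewrite AA0 mxE ltxx.
by rewrite !mxE; apply: eq_bigr => k _; rewrite !mxE.
Qed.

Lemma gram_unitmx r n (G : 'M[C]_(r, n)) :
  row_free G -> G *m G^t* \in unitmx.
Proof.
move=> fG; rewrite -row_free_unit -kermx_eq0; apply/eqP.
set K := kermx _; have KG0 : K *m (G *m G^t*) = 0 by apply: mulmx_ker.
have: (K *m G) *m (K *m G)^t* = 0.
  by rewrite trmxC_mul mulmxA -(mulmxA K) KG0 mul0mx.
by move/mulmxtC_eq0=> KG; apply: (row_free_inj fG); rewrite KG mul0mx.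
Qed.

Lemma trmxC_inv r (U : 'M[C]_r) : (invmx U)^t* = invmx (U^t*).
Proof. by rewrite trmx_inv map_invmx. Qed.

Lemma penrose_full_rank m r n (F : 'M[C]_(m, r)) (G : 'M[C]_(r, n)) :
  row_free (F^t*) -> row_free G -> exists X, penrose (F *m G) X.
Proof.
move=> fF fG; pose U := F^t* *m F; pose V := G *m G^t*.
have uV : V \in unitmx by apply: gram_unitmx.
have uU : U \in unitmx by rewrite /U -{2}(trmxCK F); apply: gram_unitmx.
have hU : U^t* = U by rewrite /U trmxC_mul trmxCK.
have hV : V^t* = V by rewrite /V trmxC_mul trmxCK.
exists (G^t* *m invmx V *m invmx U *m F^t*).
set X := _ *m F^t*; set M := F *m G.
have MX : M *m X = F *m invmx U *m F^t*.
  by rewrite /M /X !mulmxA -(mulmxA F G) -/V mulmxK.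
have XM : X *m M = G^t* *m invmx V *m G.
  by rewrite /M /X !mulmxA -(mulmxA _ (F^t*) F) -/U mulmxKV.
apply/and4P; split; apply/eqP.
- by rewrite MX /M !mulmxA -(mulmxA _ (F^t*) F) -/U mulmxKV.
- by rewrite XM /X !mulmxA -(mulmxA _ G (G^t*)) -/V mulmxKV.
- by rewrite MX !trmxC_mul trmxC_inv hU trmxCK mulmxA.
- by rewrite XM !trmxC_mul trmxC_inv hV trmxCK mulmxA.
Qed.

Lemma penrose_exists m n (M : 'M[C]_(m, n)) : exists X, penrose M X.
Proof.
rewrite -{1}(mulmx_base M); apply: penrose_full_rank; last exact: row_base_free.
by rewrite /row_free mxrank_map mxrank_tr; apply: col_base_full.
Qed.

Definition mpinv m n (M : 'M[C]_(m, n)) : 'M[C]_(n, m) :=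
  xchoose (penrose_exists M).

Lemma mpinvP m n (M : 'M[C]_(m, n)) : penrose M (mpinv M).
Proof. exact: xchooseP. Qed.

Lemma penrose_uniq m n (M : 'M[C]_(m, n)) X Y :
  penrose M X -> penrose M Y -> X = Y.
Proof.
case/and4P=> /eqP X1 /eqP X2 /eqP X3 /eqP X4.
case/and4P=> /eqP Y1 /eqP Y2 /eqP Y3 /eqP Y4.
have MXY : M *m X = M *m Y.
  by rewrite -X3 -{1}Y1 -mulmxA trmxC_mul X3 Y3 mulmxA X1.
have XYM : X *m M = Y *m M.
  by rewrite -X4 -{1}Y1 -mulmxA mulmxA trmxC_mul X4 Y4 -mulmxA [M *m _]mulmxA X1.
by rewrite -X2 -mulmxA MXY mulmxA XYM Y2.
Qed.

Definition Pbar m n (A : 'M[C]_(m, n)) : 'M[C]_m := 1%:M - A *m mpinv A.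

Definition Qbar m n (A : 'M[C]_(m, n)) : 'M[C]_n := 1%:M - mpinv A *m A.

(* [%MS] compares row spaces, hence the transposes. *)
Definition colspace_sub m n p (X : 'M[C]_(m, n)) (Y : 'M[C]_(m, p)) : bool :=
  (X^T <= Y^T)%MS.

Lemma colspace_subP m n p (X : 'M[C]_(m, n)) (Y : 'M[C]_(m, p)) :
  colspace_sub X Y <->
  (forall v : 'cV[C]_m,
     (exists x, v = X *m x) -> exists y, v = Y *m y).
Proof.
split=> [/submxP[D XY] v [x ->]|sXY].
  exists (D^T *m x); rewrite mulmxA; congr (_ *m _).
  by apply: trmx_inj; rewrite XY trmx_mul trmxK.
apply/row_subP=> i.
have [|y Ey] := sXY (col i X); first by rewrite colE; exists (delta_mx i 0).
by rewrite -tr_col Ey trmx_mul submxMl.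
Qed.

Definition ginverse m n (M : 'M[C]_(m, n)) (G : 'M[C]_(n, m)) : Prop :=
  M *m G *m M = M.

Definition parallel_summable m n (A B : 'M[C]_(m, n)) : Prop :=
  (A <> 0 \/ B <> 0) /\
  forall G H, ginverse (A + B) G -> ginverse (A + B) H ->
    A *m G *m B = A *m H *m B.

(* The parallel sum A : B, meaningful when A and B are parallel summable. *)
Definition parallel_sum m n (A B : 'M[C]_(m, n)) : 'M[C]_(m, n) :=
  A *m mpinv (A + B) *m B.

Lemma parallel_sumE m n (A B : 'M[C]_(m, n)) G :
  parallel_summable A B -> ginverse (A + B) G ->
  A *m G *m B = parallel_sum A B.
Proof.
by case=> _ invAB gG; apply: invAB => //; case/and4P: (mpinvP (A + B)) => /eqP.
Qed.

End Matrices.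

(* Main.v *)
(* As B A^* = 0, also B A^+ = A B^+ = 0 and Qbar A B^* = B^*, so A and B each
   act as A + B on their own row space. Both sides of the equivalence say that
   the column spaces of A and B meet trivially, encoded by a matrix F with
   F A = 0 and F B = B. Given F, we have A = (1 - F)(A + B) and
   B = (A + B) B^+ B, whence for every inner inverse G of A + B,
   A G B = (1 - F)(A + B) B^+ B = A B^+ B = 0. Conversely, invariance forces
   B = 0, and F = 0 will do, or A = A G (A + B), and then A G B = 0 and
   F = 1 - A G will do. *)

Require Import Defs.
From mathcomp Require Import all_boot all_order all_algebra.
From mathcomp Require Import spectral reals complex.

Import GRing.Theory.

Local Open Scope ring_scope.
Local Open Scope sesquilinear_scope.

(** For [Z = delta_mx j k], the entry [(i, l)] of [A *m Z *m B] is [A i j * B k l], so one nonzero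
    entry of [A] kills every entry of [B]. *)
Lemma mulmx_sandwich_eq0 (K : fieldType) m n p q
    (A : 'M[K]_(m, n)) (B : 'M[K]_(p, q)) :
  (forall Z, A *m Z *m B = 0) -> A = 0 \/ B = 0.
Proof.
move=> AZB; case: (eqVneq B 0) => [|/eqP B0]; [by right | left].
apply/matrixP=> i j; rewrite mxE; apply/eqP; apply: contra_notT B0 => Aij.
apply/matrixP=> k l; rewrite mxE.
have := congr1 (fun M : 'M_(m, q) => M i l) (AZB (delta_mx j k)).
rewrite -(mul_delta_mx (0 : 'I_1)) mulmxA -mulmxA -colE -rowE.
rewrite !mxE big_ord1 !mxE.
by move/eqP; rewrite mulf_eq0 (negPf Aij) => /eqP.
Qed.

Lemma colspace_subE (C : numClosedFieldType) m n p
    (X : 'M[C]_(m, n)) (Y : 'M[C]_(m, p)) :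
  colspace_sub X Y <-> exists D, X = Y *m D.
Proof.
split=> [/submxP[D XY]|[D ->]]; last by rewrite /colspace_sub trmx_mul submxMl.
by exists D^T; apply: trmx_inj; rewrite XY trmx_mul trmxK.
Qed.

Section MoorePenrose.
Set Implicit Arguments.
Unset Strict Implicit.
Variables (C : numClosedFieldType) (m n : nat).
Implicit Types A B : 'M[C]_(m, n).

Lemma mulmx_mpinvK A : A *m mpinv A *m A = A.
Proof. by case/and4P: (mpinvP A) => /eqP. Qed.

Lemma trmxC_mul_mpinv A : (A *m mpinv A)^t* = A *m mpinv A.
Proof. by case/and4P: (mpinvP A) => _ _ /eqP. Qed.

Lemma trmxC_Pbar A : (Pbar A)^t* = Pbar A.
Proof.
by rewrite /Pbar linearB /= map_mxB trmxC_mul_mpinv trmx1 map_mx1.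
Qed.

Lemma Pbar_mul A : Pbar A *m A = 0.
Proof. by rewrite mulmxBl mul1mx mulmx_mpinvK subrr. Qed.

Lemma star_orthogonal_sym A B : B *m A^t* = 0 -> A *m B^t* = 0.
Proof.
by move/(congr1 (fun M => M^t*)); rewrite trmxC_mul trmxCK trmx0 map_mx0.
Qed.

(** The column space of [mpinv A] lies in that of [A^t*]: with [X = mpinv A],
    [X = (X *m A)^t* *m X = A^t* *m X^t* *m X]. *)
Lemma star_orthogonal_mpinv A B : B *m A^t* = 0 -> B *m mpinv A = 0.
Proof.
case/and4P: (mpinvP A) => _ /eqP A2 _ /eqP A4 BA.
by rewrite -A2 -A4 trmxC_mul !mulmxA BA !mul0mx.
Qed.

Lemma Qbar_star_orthogonal A B : B *m A^t* = 0 -> Qbar A *m B^t* = B^t*.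
Proof.
move=> BA; rewrite mulmxBl mul1mx -mulmxA (star_orthogonal_sym BA).
by rewrite mulmx0 subr0.
Qed.

Lemma separating_mx_ginverse A B F G :
  B *m A^t* = 0 -> F *m A = 0 -> F *m B = B -> ginverse (A + B) G ->
  A *m G *m B = 0.
Proof.
move=> BA FA FB gG.
have AB := star_orthogonal_mpinv (star_orthogonal_sym BA).
have EA : A = (1%:M - F) *m (A + B).
  by rewrite mulmxBl mul1mx mulmxDr FA FB add0r addrK.
have EB : B = (A + B) *m mpinv B *m B.
  by rewrite !mulmxDl AB mul0mx add0r mulmx_mpinvK.
rewrite {1}EA {2}EB -!mulmxA (mulmxA G) (mulmxA (A + B) (G *m _)).
by rewrite (mulmxA (A + B) G) gG !mulmxA -EA AB mul0mx.
Qed.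

Lemma parallel_summable_separating A B :
  B *m A^t* = 0 -> parallel_summable A B ->
  exists F, F *m A = 0 /\ F *m B = B.
Proof.
move=> BA [_ invAB]; set M := A + B; pose G := mpinv M.
have gG : M *m G *m M = M := mulmx_mpinvK M.
(* As [M *m (1%:M - G *m M) = 0], adding [(1%:M - G *m M) *m Z] to [G] gives another inner inverse
   of [M], whatever [Z] is; invariance then makes the difference of the two products vanish. *)
have /mulmx_sandwich_eq0[AGM|->] : forall Z, A *m (1%:M - G *m M) *m Z *m B = 0.
- move=> Z; have gH : ginverse M (G + (1%:M - G *m M) *m Z).
    rewrite /ginverse (mulmxDr M) mulmxA (mulmxBr M) mulmx1 (mulmxA M).
    by rewrite gG subrr mul0mx addr0.
  have := invAB _ _ gH gG; rewrite mulmxDr mulmxDl !mulmxA => /eqP.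
  by rewrite addrC -subr_eq0 addrK => /eqP.
- have EA : A *m G *m M = A.
    by apply/esym/eqP; rewrite -subr_eq0 -mulmxA -{1}[A]mulmx1 -mulmxBr AGM.
  have AB := star_orthogonal_mpinv (star_orthogonal_sym BA).
  have AGB : A *m G *m B = 0.
    have EB : B = M *m mpinv B *m B.
      by rewrite /M !mulmxDl AB mul0mx add0r mulmx_mpinvK.
    by rewrite EB !mulmxA EA AB mul0mx.
  (* Expanding [A = A *m G *m (A + B)] with [A *m G *m B = 0] leaves [A = A *m G *m A], so this
     matrix kills [A] and fixes [B]. *)
  exists (1%:M - A *m G); rewrite !mulmxBl !mul1mx AGB subr0; split=> //.
  by rewrite -{1}EA mulmxDr AGB addr0 subrr.
- by exists 0; rewrite !mul0mx.
Qed.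

(** [F *m A = 0] gives [F = F *m Pbar A], so the adjoint of [F *m B = B] factors [B^t*] through
    [B^t* *m Pbar A]. *)
Lemma separating_mx_colspace A B :
  (exists F, F *m A = 0 /\ F *m B = B) <->
  colspace_sub (B^t* *m A) (B^t* *m Pbar A).
Proof.
split=> [[F [FA FB]]|/colspace_subE[D BA]].
  have FP : F *m Pbar A = F by rewrite mulmxBr mulmx1 mulmxA FA mul0mx subr0.
  apply/colspace_subE; exists (F^t* *m A).
  by rewrite -{1}FB -{1}FP !trmxC_mul trmxC_Pbar !mulmxA.
(* The witness comes from splitting [B^t*] along [1%:M = A *m mpinv A + Pbar A] and replacing
   [B^t* *m A] by [B^t* *m Pbar A *m D]. *)
exists ((D *m mpinv A + 1%:M)^t* *m Pbar A); split.
  by rewrite -mulmxA Pbar_mul mulmx0.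
rewrite -[LHS]trmxCK -[RHS]trmxCK; congr (_^t*).
rewrite !trmxC_mul trmxC_Pbar trmxCK mulmxA mulmxDr mulmx1 mulmxA -BA.
rewrite -mulmxA -mulmxDr.
by rewrite /Pbar addrC subrK mulmx1.
Qed.

End MoorePenrose.

Theorem theorem2p12 (R : realType) (m n : nat) (A B : 'M[R[i]]_(m, n)) :
  A <> 0 \/ B <> 0 ->
  B *m A^t* = 0 ->
  (parallel_summable A B <->
     colspace_sub (Qbar A *m B^t* *m A) (Qbar A *m B^t* *m Pbar A)) /\
  (parallel_summable A B -> parallel_sum A B = 0).
Proof.
move=> AB0 BA; rewrite (Qbar_star_orthogonal BA); split; [split|].
- by move=> sAB; apply/separating_mx_colspace/parallel_summable_separating.
- case/separating_mx_colspace=> F [FA FB]; split=> // G H gG gH.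
  rewrite (separating_mx_ginverse BA FA FB gG).
  by rewrite (separating_mx_ginverse BA FA FB gH).
- case/(parallel_summable_separating BA)=> F [FA FB].
  apply: (separating_mx_ginverse BA FA FB).
  exact: mulmx_mpinvK.
Qed.
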